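(* Let $d\in\mathbb N$, $A\in\mathrm{SL}(d,\mathbb Z)$, and $b\in\mathbb T^d$ be given (with $b$ also denoting a fixed representative in $\mathbb R^d$), let $T_{A,b}:\mathbb T^d\to\mathbb T^d$ be $T_{A,b}\,\omega=A\omega+b$, and let $\mu$ be a $T_{A,b}$-ergodic measure. Then $$\mathfrak A(\mathbb T^d,T_{A,b},\mu)=\bigl\{\langle k,b\rangle+n:n\in\mathbb Z\text{ and }k\in\mathbb Z^d\cap\ker(I-A^* )\bigr\}.$$
   Context: $\mathbb T=\mathbb R/\mathbb Z$, $\mathbb T^d=\mathbb R^d/\mathbb Z^d$; $A^*$ is the transpose of $A$, $\langle\cdot,\cdot\rangle$ the standard inner product. The set on the right side is a subset of $\mathbb R$ and does not depend on the representative of $b$. Ergodic measures are Borel probability measures. For a compact metric space $\Omega$, homeomorphism $T:\Omega\to\Omega$ and $T$-ergodic Borel probability measure $\mu$: the suspension is $X=(\Omega\times\mathbb R)/\!\sim$, where $(\omega,t)\sim(\omega',t')$ iff $(\omega',t')=(T^n\omega,t-n)$ for some $n\in\mathbb Z$, with classes $[\omega,t]$, flow $\overline T^{t}[\omega,s]=[\omega,s+t]$, and $\overline T$-ergodic measure $\overline\mu$ given by $\int_X g\,d\overline\mu=\int_0^1\int_\Omega g[\omega,s]\,d\mu(\omega)\,ds$. $C^\sharp(X,\mathbb T)$ is the group of homotopy classes of continuous maps $X\to\mathbb T$ (pointwise addition). For $\phi\in C(X,\mathbb T)$, $x\in X$, let $\widetilde\phi_x:\mathbb R\to\mathbb R$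 be a continuous lift of $t\mapsto\phi(\overline T^{t}x)$. For $\overline\mu$-a.e. $x$, $\lim_{t\to\infty}\widetilde\phi_x(t)/t$ exists and equals a constant depending only on $[\phi]$, denoted $\mathfrak A_{\overline\mu}([\phi])$ (the Schwartzman homomorphism). $\mathfrak A(\Omega,T,\mu)=\mathfrak A_{\overline\mu}(C^\sharp(X,\mathbb T))\subseteq\mathbb R$ is its range. *)

(* Defs.v *)
From HB Require Import structures.
From mathcomp Require Import all_boot all_order all_algebra.
From mathcomp Require Import all_classical all_reals all_analysis.
From mathcomp Require Import measurable_realfun.

Set Implicit Arguments.
Unset Strict Implicit.
Unset Printing Implicit Defensive.

Import Order.TTheory GRing.Theory Num.Theory.
Import numFieldNormedType.Exports.

Local Open Scope classical_set_scope.
Local Open Scope ring_scope.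
Local Open Scope quotient_scope.

Section ZmodQuotient.
Variables (V : zmodType) (L : zmodClosed V).

Definition cong (x y : V) : bool := x - y \in L.

Let cong_refl : reflexive cong.
Proof. by move=> x; rewrite /cong subrr rpred0. Qed.

Let cong_sym : symmetric cong.
Proof. by move=> x y; rewrite /cong -opprB rpredN. Qed.

Let cong_trans : transitive cong.
Proof.
move=> y x z xy yz; rewrite /cong.
by have := rpredD xy yz; rewrite addrA subrK.
Qed.

Canonical cong_equiv := EquivRel cong cong_refl cong_sym cong_trans.

(* The quotient group V / L. *)
Definition zquot : Type := {eq_quot cong_equiv}.
HB.instance Definition _ := Choice.on zquot.
HB.instance Definition _ := EqQuotient.on zquot.

Lemma zquotP x y : reflect (\pi_zquot x = \pi_zquot y) (x - y \in L).
Proof. exact: eqmodP. Qed.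

Definition zquot0 : zquot := \pi_zquot 0.
Definition zquotN (a : zquot) : zquot := \pi_zquot (- repr a).
Definition zquotD (a b : zquot) : zquot := \pi_zquot (repr a + repr b).

Lemma repr_zquot (x : V) : repr (\pi_zquot x) - x \in L.
Proof. by apply/zquotP; rewrite reprK. Qed.

Lemma zquotN_pi x : zquotN (\pi_zquot x) = \pi_zquot (- x).
Proof. by rewrite /zquotN; apply/zquotP; rewrite -opprD rpredN repr_zquot. Qed.

Lemma zquotD_pi x y : zquotD (\pi_zquot x) (\pi_zquot y) = \pi_zquot (x + y).
Proof.
by rewrite /zquotD; apply/zquotP; rewrite opprD addrACA rpredD ?repr_zquot.
Qed.

Let zquotA : associative zquotD.
Proof.
move=> a b c; rewrite -(reprK a) -(reprK b) -(reprK c).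
rewrite (zquotD_pi (repr b) (repr c)) (zquotD_pi (repr a) (repr b)).
by rewrite !zquotD_pi addrA.
Qed.

Let zquotC : commutative zquotD.
Proof. by move=> a b; rewrite -(reprK a) -(reprK b) !zquotD_pi addrC. Qed.

Let zquot0D : left_id zquot0 zquotD.
Proof. by move=> a; rewrite -(reprK a) zquotD_pi add0r. Qed.

Let zquotND : left_inverse zquot0 zquotN zquotD.
Proof. by move=> a; rewrite -(reprK a) zquotN_pi zquotD_pi addNr. Qed.

HB.instance Definition _ :=
  GRing.isZmodule.Build zquot zquotA zquotC zquot0D zquotND.

End ZmodQuotient.

Section Tori.
Variable R : realType.

(* Z as a subgroup of R; circle = R/Z and torus = R^d/Z^d carry the quotient
   topology. *)
Definition Zpts : {pred R} := fun x => x \is a Num.int.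

Let Zpts_zmod : zmod_closed Zpts.
Proof. by split=> [|x y]; [exact: rpred0 | exact: rpredB]. Qed.

HB.instance Definition _ := GRing.isZmodClosed.Build R Zpts Zpts_zmod.

Definition circle : Type := quotient_topology (zquot Zpts).
HB.instance Definition _ := PointedTopological.on circle.
HB.instance Definition _ := Quotient.on circle.
HB.instance Definition _ := GRing.Zmodule.copy circle (zquot Zpts).

Variable d : nat.

Definition Zdpts : {pred 'cV[R]_d} := fun x => [forall i, x i 0 \is a Num.int].

Let Zdpts_zmod : zmod_closed Zdpts.
Proof.
split=> [|x y /forallP xZ /forallP yZ]; apply/forallP => i; rewrite !mxE.
  exact: rpred0.
by rewrite rpredB.
Qed.

HB.instance Definition _ := GRing.isZmodClosed.Build 'cV[R]_d Zdpts Zdpts_zmod.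

Definition torus : Type := quotient_topology (zquot Zdpts).
HB.instance Definition _ := PointedTopological.on torus.
HB.instance Definition _ := Quotient.on torus.
HB.instance Definition _ := GRing.Zmodule.copy torus (zquot Zdpts).

End Tori.

(* A homeomorphism bundled with its inverse, so that negative iterates make
   sense. *)
Record homeo (X : topologicalType) := Homeo {
  hfun :> X -> X;
  hinv : X -> X;
  hfunK : cancel hfun hinv;
  hinvK : cancel hinv hfun;
  hfun_continuous : continuous hfun;
  hinv_continuous : continuous hinv }.

(* hiter T n = T^n for n in Z. *)
Definition hiter (X : topologicalType) (T : homeo X) (n : int) (w : X) : X :=
  match n with
  | Posz k => iter k T w
  | Negz k => iter k.+1 (hinv T) w
  end.

Section HomeoIter.
Variables (X : topologicalType) (T : homeo X).

Lemma hiterS n w : hiter T (n + 1) w = T (hiter T n w).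
Proof.
case: n => [n|[|n]]; first by rewrite -PoszD addn1.
  by rewrite /= hinvK.
have -> : Negz n.+1 + 1 = Negz n.
  by rewrite !NegzE -[n.+2]addn1 PoszD opprD subrK.
by rewrite /= hinvK.
Qed.

Lemma hiterD m n w : hiter T (m + n) w = hiter T m (hiter T n w).
Proof.
have hP k l v : hiter T (Posz k + l) v = hiter T k (hiter T l v).
  elim: k => [|k IHk]; first by rewrite add0r.
  by rewrite -addn1 PoszD addrAC hiterS IHk hiterS.
case: m => [k|k]; first exact: hP.
have Tinj j : injective (hiter T (Posz j)).
  elim: j => [|j IHj] x y //=; move/(can_inj (hfunK T)); exact: IHj.
by apply: (Tinj k.+1); rewrite -!hP addrA NegzE subrr add0r.
Qed.

End HomeoIter.

Section TorusAffine.
Variables (R : realType) (d : nat).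
Implicit Types (A B : 'M[int]_d) (b w : torus R d).

Definition torus_mul A w : torus R d :=
  \pi_(torus R d) (map_mx intr A *m repr w).

Lemma torus_mul_pi A (x : 'cV[R]_d) :
  torus_mul A (\pi_(torus R d) x) = \pi_(torus R d) (map_mx intr A *m x).
Proof.
rewrite /torus_mul; apply/zquotP; rewrite -mulmxBr.
have /forallP := repr_zquot (Zdpts (R := R) (d := d)) x => h.
apply/forallP => i; rewrite mxE rpred_sum// => j _.
by rewrite mxE rpredM ?intr_int.
Qed.

Lemma torusD_pi (x y : 'cV[R]_d) :
  \pi_(torus R d) x + \pi_(torus R d) y = \pi_(torus R d) (x + y).
Proof. exact: zquotD_pi. Qed.

Lemma torus_mul1 w : torus_mul 1%:M w = w.
Proof. by rewrite /torus_mul map_mx1 mul1mx reprK. Qed.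

Lemma torus_mulM A B w : torus_mul (A *m B) w = torus_mul A (torus_mul B w).
Proof. by rewrite -(reprK w) (torus_mul_pi B (repr w)) !torus_mul_pi mulmxA -map_mxM. Qed.

Let continuous_coord m (f : 'cV[R]_d -> 'cV[R]_m) :
  (forall i, continuous (fun x => f x i 0)) -> continuous f.
Proof.
move=> fc x A [P nP PA]; have h i j : \forall y \near x, P i j (f y i j).
  by rewrite (ord1 j); apply: fc; exact: nP.
suff: \forall y \near x, A (f y) by [].
have : \forall y \near x, forall i j, P i j (f y i j).
  apply: (@filter_forall _ _ (fun i y => forall j, P i j (f y i j)) _
    (nbhs_filter x)) => i.
  exact: (@filter_forall _ _ (fun j y => P i j (f y i j)) _
    (nbhs_filter x) (h i)).
by apply: filterS => y Hy; exact: PA.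
Qed.

Lemma torus_mul_continuous A : continuous (torus_mul A).
Proof.
apply/quotient_continuous.
have -> : torus_mul A \o \pi_(torus R d) =
    \pi_(torus R d) \o (fun v => map_mx intr A *m v).
  by apply/funext => x; exact: torus_mul_pi.
move=> x; apply: continuous_comp; last exact: pi_continuous.
move: x; apply: continuous_coord => i.
under eq_fun do rewrite mxE.
apply: continuous_big => [|j _ x]; first exact: add_continuous.
have c1 : {for x, continuous (fun=> map_mx intr A i j : R)}.
  exact: cst_continuous.
have c2 : {for x, continuous (fun v : 'cV[R]_d => v j 0)}.
  exact: coord_continuous.
exact: continuousM c1 c2.
Qed.

Lemma torus_add_continuous b : continuous (fun w : torus R d => w + b).
Proof.
apply/quotient_continuous.
have -> : (fun w : torus R d => w + b) \o \pi_(torus R d) =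
    \pi_(torus R d) \o (fun v => v + repr b).
  by apply/funext => x /=; rewrite -torusD_pi reprK.
move=> x; apply: continuous_comp; last exact: pi_continuous.
have c1 : {for x, continuous (fun v : 'cV[R]_d => v)} by move=> U.
have c2 : {for x, continuous (fun=> repr b : 'cV[R]_d)}.
  exact: cst_continuous.
exact: continuousD c1 c2.
Qed.

Definition torus_affine A b w : torus R d := torus_mul A w + b.

Variables (A : 'M[int]_d) (detA : \det A = 1) (b : torus R d).

Let A_unit : A \in unitmx.
Proof. by rewrite unitmxE detA unitr1. Qed.

Let torus_affineK :
  cancel (torus_affine A b) (fun w => torus_mul (invmx A) (w - b)).
Proof. by move=> w; rewrite /torus_affine addrK -torus_mulM mulVmx// torus_mul1. Qed.

Let torus_affineVK :
  cancel (fun w => torus_mul (invmx A) (w - b)) (torus_affine A b).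
Proof. by move=> w; rewrite /torus_affine -torus_mulM mulmxV// torus_mul1 subrK. Qed.

Let torus_affine_continuous : continuous (torus_affine A b).
Proof.
move=> w; apply: (@continuous_comp _ _ _ (torus_mul A)
  (fun v : torus R d => v + b)).
  exact: torus_mul_continuous.
exact: torus_add_continuous.
Qed.

Let torus_affineV_continuous :
  continuous (fun w => torus_mul (invmx A) (w - b)).
Proof.
move=> w; apply: (@continuous_comp _ _ _ 
  (fun v : torus R d => v - b) (torus_mul _)).
  exact: torus_add_continuous.
exact: torus_mul_continuous.
Qed.

(* The map w |-> A w + b, with inverse w |-> A^-1 (w - b). *)
Definition torus_homeo : homeo (torus R d) :=
  Homeo torus_affineK torus_affineVK torus_affine_continuous
    torus_affineV_continuous.

End TorusAffine.

Definition borel (X : ptopologicalType) := g_sigma_algebraType (@open X).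

Section Ergodic.
Variables (R : realType) (X : ptopologicalType).

(* T-invariance is part of being T-ergodic. *)
Definition ergodic (T : X -> X) (mu : probability (borel X) R) :=
  (forall B : set (borel X), measurable B -> mu (T @^-1` B) = mu B) /\
  (forall B : set (borel X), measurable B -> T @^-1` B = B ->
    mu B = 0%E \/ mu B = 1%E).

End Ergodic.

Section Suspension.
Variables (R : realType) (X : ptopologicalType) (T : homeo X).

Definition susp_rel (p q : X * R) : bool :=
  `[< exists n : int, q = (hiter T n p.1, p.2 - n%:~R) >].

Let susp_refl : reflexive susp_rel.
Proof. by move=> [w t]; apply/asboolP; exists 0; rewrite subr0. Qed.

Let susp_relV p q : susp_rel p q -> susp_rel q p.
Proof.
move=> /asboolP[n ->]; apply/asboolP; exists (- n); case: p => w t /=.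
by rewrite -hiterD addNr rmorphN/= opprK subrK.
Qed.

Let susp_sym : symmetric susp_rel.
Proof. by move=> p q; apply/idP/idP; exact: susp_relV. Qed.

Let susp_trans : transitive susp_rel.
Proof.
move=> q p r /asboolP[m ->] /asboolP[n ->]; apply/asboolP; exists (n + m).
by rewrite /= hiterD rmorphD/= opprD addrA addrAC.
Qed.

Canonical susp_equiv := EquivRel susp_rel susp_refl susp_sym susp_trans.

(* Compactness and metrizability of X play no role in the constructions from
   here on; X is a nonempty topological space. *)
Definition susp : Type := quotient_topology {eq_quot susp_equiv}.
HB.instance Definition _ := Topological.on susp.
HB.instance Definition _ := Quotient.on susp.
HB.instance Definition _ := isPointed.Build susp (\pi_susp (point, 0)).

Lemma suspP (p q : X * R) :
  \pi_susp p = \pi_susp q <->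
  exists n : int, q = (hiter T n p.1, p.2 - n%:~R).
Proof. by split=> [/eqmodP/asboolP//|h]; apply/eqmodP/asboolP. Qed.

Definition susp_flow (t : R) (x : susp) : susp :=
  \pi_susp ((repr x).1, (repr x).2 + t).

Lemma susp_flow_pi t w s : susp_flow t (\pi_susp (w, s)) = \pi_susp (w, s + t).
Proof.
rewrite /susp_flow.
have /suspP[n] : \pi_susp (repr (\pi_susp (w, s))) = \pi_susp (w, s).
  by rewrite reprK.
case: (repr _) => w' s' /= [-> ->]; apply/suspP; exists n => /=.
by rewrite addrAC.
Qed.

End Suspension.

Section SuspensionMeasure.
Variables (R : realType) (X : ptopologicalType) (T : homeo X).
Variable mu : probability (borel X) R.
Local Open Scope ereal_scope.
Local Notation S := (susp R T).

Definition slice (B : set S) (s : R) : set (borel X) :=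
  [set w | B (\pi_S (w, s))].

Let slice_continuous (s : R) : continuous (fun w : X => \pi_S (w, s)).
Proof.
move=> w; apply: (@continuous_comp _ _ _ (fun w : X => (w, s)) \pi_S).
  move=> V [[A B] /= [nA nB] AB].
  suff: \forall v \near w, V (v, s) by [].
  apply: filterS nA => v Av; apply: AB; split => //=.
  exact: nbhs_singleton nB.
exact: pi_continuous.
Qed.

Let measurable_slice (B : set (borel S)) s :
  measurable B -> measurable (slice B s).
Proof.
move=> mB; rewrite -[slice _ _]setTI.
have : measurable_fun setT (fun w : borel X => \pi_S (w, s) : borel S).
  apply: (measurability (@open S : set (set (borel S)))) => // _ [U oU <-].
  rewrite setTI; apply: sub_sigma_algebra.
  by have /continuousP := @slice_continuous s; exact.
by move=> /(_ measurableT B mB).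
Qed.

Let mu_slice_open (U : set S) : open U ->
  lower_semicontinuous (fun s => mu (slice U s)).
Proof.
move=> oU s a; pose V := \pi_S @^-1` U.
have oV : open V by [].
pose W n := interior [set w : X | forall t, ball s (n.+1%:R^-1)%R t -> V (w, t)].
have mW n : measurable (W n : set (borel X)).
  by apply: sub_sigma_algebra; exact: open_interior.
have Wslice : slice U s = \bigcup_n (W n).
  apply/seteqP; split => [w Vw|w [n _ /interior_subset]]; last first.
    by apply; exact: ballxx.
  have [[A B] /= [nA /nbhs_ballP[e /= e0 eB]] AB] : nbhs (w, s) V.
    exact: open_nbhs_nbhs.
  near \oo => n; exists n => //; apply: filterS nA => v Av t st.
  apply: (AB (v, t)); split => //=; apply: eB; apply: le_ball st.
  by apply: ltW; near: n; exact: near_infty_natSinv_lt (PosNum e0).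
rewrite Wslice => amu.
have muW : mu \o W @ \oo --> mu (\bigcup_n W n).
  apply: nondecreasing_cvg_mu => //; first exact: bigcupT_measurable.
  move=> m n mn; apply/subsetPset; apply: interiorS => w mw t nt.
  apply: mw; apply: le_ball nt.
  by rewrite lef_pV2 ?posrE// ler_nat.
have [n an] : exists n, a%:E < mu (W n).
  apply: contrapT => /forallNP h; move: amu; apply/negP; rewrite -leNgt.
  rewrite -(cvg_lim _ muW)//; apply: lime_le; first by apply/cvg_ex; eexists; exact: muW.
  by apply: nearW => n /=; rewrite leNgt; apply/negP; exact: h.
exists (ball s (n.+1%:R^-1)%R); first by apply: nbhsx_ballx.
move=> t st; apply: (lt_le_trans an); apply: le_measure; rewrite ?inE//.
  apply: measurable_slice; exact: sub_sigma_algebra.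
by move=> w /interior_subset; apply.
Unshelve. all: by end_near. Qed.

Let measurable_mu_slice (B : set (borel S)) :
  measurable B -> measurable_fun setT (fun s : R => mu (slice B s)).
Proof.
move: B; apply: dynkin_induction => //.
- by move=> U V oU oV; exact: openI.
- rewrite (_ : (fun _ => _) = cst (mu setT)); first exact: measurable_cst.
  by apply/funext => s.
- move=> U oU; apply: lower_semicontinuous_measurable; exact: mu_slice_open.
- move=> B mB mF; rewrite (_ : (fun _ => _) = (fun s => 1 - mu (slice B s))).
    exact: emeasurable_funB.
  apply/funext => s; rewrite -probability_setC//; exact: measurable_slice.
- move=> F mF tF mmuF.
  rewrite (_ : (fun _ => _) = (fun s => \sum_(n <oo) mu (slice (F n) s))).
    by apply: ge0_emeasurable_sum.
  apply/funext => s; rewrite -measure_semi_bigcup//.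
  + by move=> n; exact: measurable_slice.
  + move=> i j _ _ [w [Fi Fj]]; apply: tF => //.
    by exists (\pi_S (w, s)).
  + apply: bigcupT_measurable => n; exact: measurable_slice.
Qed.

(* The formula int g d(mubar) = int_0^1 int_X g[w,s] dmu(w) ds, applied to the
   indicator function g of B. *)
Definition susp_measure (B : set (borel S)) : \bar R :=
  \int[lebesgue_measure]_(s in `[0%R, 1%R]) mu (slice B s).

Let susp_measure0 : susp_measure set0 = 0.
Proof. by apply: integral0_eq => s _; exact: measure0. Qed.

Let susp_measure_ge0 B : 0 <= susp_measure B.
Proof. exact: integral_ge0. Qed.

Let susp_measure_sigma_additive : semi_sigma_additive susp_measure.
Proof.
move=> F mF tF mUF.
have -> : susp_measure (\bigcup_n F n) = \sum_(n <oo) susp_measure (F n).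
  rewrite -integral_nneseries//; last first.
    by move=> n; apply: measurable_funTS; exact: measurable_mu_slice.
  apply: eq_integral => s _; rewrite -measure_semi_bigcup//.
  + by move=> n; exact: measurable_slice.
  + move=> i j _ _ [w [Fi Fj]]; apply: tF => //.
    by exists (\pi_S (w, s)).
  + apply: bigcupT_measurable => n; exact: measurable_slice.
by apply: is_cvg_ereal_nneg_natsum => n _; exact: susp_measure_ge0.
Qed.

HB.instance Definition _ := isMeasure.Build _ _ _ susp_measure
  susp_measure0 susp_measure_ge0 susp_measure_sigma_additive.

Let susp_measure_setT : susp_measure setT = 1.
Proof.
rewrite /susp_measure.
under eq_integral do rewrite (_ : slice _ _ = setT)// probability_setT.
rewrite integral_cst//= lebesgue_measure_itv/= lte01 oppr0 adde0 mule1.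
by [].
Qed.

HB.instance Definition _ :=
  Measure_isProbability.Build _ _ _ susp_measure susp_measure_setT.

End SuspensionMeasure.

Arguments susp_measure {R X} T mu B.

Section Schwartzman.
Variable R : realType.

(* A continuous f : R -> circle always has a lift, unique up to an additive
   integer constant. *)
Definition is_lift (f : R -> circle R) (g : R -> R) :=
  continuous g /\ forall t, \pi_(circle R) (g t) = f t.

Definition homotopic (Y : topologicalType) (f g : Y -> circle R) :=
  exists H : Y * R -> circle R,
    [/\ {within [set: Y] `*` `[0, 1]%classic, continuous H},
        forall y, H (y, 0) = f y & forall y, H (y, 1) = g y].

Definition homotopy_class (Y : topologicalType) (f : Y -> circle R) :
    set (Y -> circle R) :=
  [set g | continuous g /\ homotopic f g].

(* The set of homotopy classes of continuous maps Y -> circle, each class being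
   represented by the set of its members. *)
Definition Csharp (Y : topologicalType) : set (set (Y -> circle R)) :=
  [set homotopy_class f | f in [set f : Y -> circle R | continuous f]].

Variables (X : ptopologicalType) (T : homeo X) (mu : probability (borel X) R).

(* As two lifts differ by a constant, the limit does not depend on the choice of
   g. *)
Definition winding_rate (phi : susp R T -> circle R) (a : R) :=
  {ae susp_measure T mu, forall x : borel (susp R T),
    exists2 g : R -> R, is_lift (fun t => phi (susp_flow t x)) g &
      g t / t @[t --> +oo] --> a}.

(* The value on a class c is the constant which is the rate of every
   representative of c almost everywhere; it is unique since mubar has total
   mass 1. *)
Definition schwartzman (c : set (susp R T -> circle R)) : R :=
  get [set a | forall phi, c phi -> winding_rate phi a].

Definition schwartzman_range : set R := schwartzman @` @Csharp (susp R T).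

End Schwartzman.

(* Main.v *)
(* Pull phi back to R^d x R and lift it to a real function g. Under each integer
   translation, and under (x, t) |-> (A x + b0, t - 1), g changes by a constant
   integer; the constants of the translations have the form <k, m>, and
   comparing the two kinds of maps gives A^T k = k and a further integer n.
   Hence g(x, t) - <k, x> - t (<k, b0> + n) is invariant, so by compactness of
   the suspension it is bounded along every orbit, and phi has the rate
   <k, b0> + n along every orbit. A homotopic map differs from phi by the
   projection of a continuous real function on the suspension, which is bounded,
   so it has the same rate. Conversely <k, x> + t (<k, b0> + n) descends to the
   suspension. *)

From HB Require Import structures.
Require Import Defs.
From mathcomp Require Import all_boot all_order all_algebra.
From mathcomp Require Import all_classical all_reals all_analysis.
From mathcomp Require Import lra ring.

Set Implicit Arguments.
Unset Strict Implicit.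
Unset Printing Implicit Defensive.

Import Order.TTheory GRing.Theory Num.Theory.
Import numFieldNormedType.Exports.
Local Open Scope classical_set_scope.
Local Open Scope ring_scope.
Local Open Scope quotient_scope.

Lemma continuous_pair (Y U V : topologicalType) (f : Y -> U) (g : Y -> V) y :
  {for y, continuous f} -> {for y, continuous g} ->
  {for y, continuous (fun y => (f y, g y))}.
Proof. by move=> cf cg; exact: cvg_pair cf cg. Qed.

Lemma zquotB_pi (V : zmodType) (L : zmodClosed V) (x y : V) :
  \pi_(zquot L) x - \pi_(zquot L) y = \pi_(zquot L) (x - y).
Proof. by rewrite [- \pi_(zquot L) y]zquotN_pi [LHS]zquotD_pi. Qed.

Section QuotientTopology.
Variables (V : topologicalZmodType) (L : zmodClosed V).
Local Notation Q := (quotient_topology (zquot L)).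

Lemma zquot_pi_open (U : set V) : open U -> open (\pi_Q @` U).
Proof.
move=> oU; suff : open (\pi_Q @^-1` (\pi_Q @` U)) by [].
have -> : \pi_Q @^-1` (\pi_Q @` U) =
    \bigcup_(l in [set l | l \in L]) (fun x => x + l) @^-1` U.
  apply/seteqP; split => [x [y Uy /zquotP xy]|x [l Ll Ul]].
    by exists (y - x) => //=; rewrite addrC subrK.
  by exists (x + l) => //; apply/zquotP; rewrite addrC addKr.
apply: bigcup_open => l _; apply: open_comp => // x _.
apply: (@continuous_comp V (V * V)%type V (fun x => (x, l))
  (fun xy => xy.1 + xy.2)).
  by apply: cvg_pair; [exact: cvg_id|exact: cvg_cst].
exact: add_continuous.
Qed.

Lemma nbhs_zquot_pi (x : V) (W : set Q) :
  nbhs (\pi_Q x) W <-> nbhs x (\pi_Q @^-1` W).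
Proof.
split => [|]; first exact: (@pi_continuous _ _ x).
rewrite !nbhsE => -[U [oU Ux] UW]; exists (\pi_Q @` U).
  by split; [exact: zquot_pi_open|exists x].
by move=> _ [y Uy <-]; exact: UW.
Qed.

End QuotientTopology.

Section Circle.
Variable R : realType.
Local Notation C := (circle R).
Local Notation pi := (\pi_C).

Lemma circle_piP (x y : R) : pi x = pi y <-> x - y \is a Num.int.
Proof. by split => [/zquotP|/(zquotP (Zpts (R := R)))]. Qed.

Lemma circle_piD (x y : R) : pi (x + y) = pi x + pi y.
Proof. by rewrite [RHS]zquotD_pi. Qed.

Lemma circle_piB (x y : R) : pi (x - y) = pi x - pi y.
Proof. by rewrite [RHS](@zquotB_pi _ (Zpts (R := R))). Qed.

Lemma circle_pi0 : pi 0 = 0.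
Proof. by []. Qed.

Lemma circle_pi_int (x : R) : x \is a Num.int -> pi x = 0.
Proof. by move=> xZ; rewrite -circle_pi0; apply/circle_piP; rewrite subr0. Qed.

Lemma circle_pi_sum (I : Type) (r : seq I) (F : I -> R) :
  pi (\sum_(i <- r) F i) = \sum_(i <- r) pi (F i).
Proof. by elim/big_rec2: _ => // i y x _ <-; rewrite circle_piD. Qed.

Lemma nbhs_circle_pi (x : R) (W : set C) :
  nbhs (pi x) W <-> nbhs x (pi @^-1` W).
Proof. exact: (@nbhs_zquot_pi R (Zpts (R := R))). Qed.

Lemma circleB_continuous : continuous (fun uv : C * C => uv.1 - uv.2).
Proof.
move=> [u v]; rewrite -(reprK u) -(reprK v) => W /=.
rewrite -circle_piB => /nbhs_circle_pi nW.
have sub_cont :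
    {for (repr u, repr v), continuous (fun xy : R * R => xy.1 - xy.2)}.
  have c1 : {for (repr u, repr v), continuous (fun xy : R * R => xy.1 : R)}.
    exact: cvg_fst.
  have c2 : {for (repr u, repr v), continuous (fun xy : R * R => xy.2 : R)}.
    exact: cvg_snd.
  exact: continuousB c1 c2.
have [[P Q] /= [nP nQ] PQ] := sub_cont _ nW.
exists (pi @` P, pi @` Q); rewrite /=.
  by split; apply/nbhs_circle_pi; [move: nP|move: nQ];
    apply: (@filterS R); move=> y ?; exists y.
move=> [_ _] /= [[x Px <-] [y Qy <-]].
by rewrite -circle_piB; apply: (PQ (x, y)).
Qed.

Lemma continuous_circleB (Y : topologicalType) (f g : Y -> C) :
  continuous f -> continuous g -> continuous (fun y => f y - g y).
Proof.
move=> cf cg y; apply: (@continuous_comp Y (C * C)%type C (fun y => (f y, g y))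
    (fun uv => uv.1 - uv.2)).
  exact: cvg_pair (cf y) (cg y).
exact: circleB_continuous.
Qed.

(* The representative of u in [-1/2, 1/2). *)
Definition centered (u : C) : R := repr u - (Num.floor (repr u + 1/2))%:~R.

Lemma centeredK : cancel centered pi.
Proof.
move=> u; rewrite -[RHS]reprK; apply/circle_piP.
by rewrite /centered addrAC subrr sub0r rpredN intr_int.
Qed.

Lemma centered_pi (x : R) : `|x| < 1/2 -> centered (pi x) = x.
Proof.
rewrite ltr_norml => /andP[x1 x2]; rewrite /centered.
have /circle_piP/intrP[n rx] : pi (repr (pi x)) = pi x by rewrite reprK.
have -> : repr (pi x) = x + n%:~R by rewrite -rx addrC subrK.
rewrite (_ : Num.floor _ = n) ?addrK//; apply: floor_def.
by rewrite rmorphD /=; apply/andP; split; lra.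
Qed.

Lemma centered0 : centered 0 = 0.
Proof. by rewrite -circle_pi0 centered_pi ?normr0//; lra. Qed.

Lemma centered_continuous (u : C) :
  `|centered u| < 1/2 -> {for u, continuous centered}.
Proof.
move=> uh W nW.
suff : nbhs (pi (centered u)) (centered @^-1` W) by rewrite centeredK.
apply/nbhs_circle_pi.
have : \forall y \near centered u, `|y| < 1/2.
  exact: (@cvgr_norm_lt R R^o R (nbhs (centered u)) _ id (centered u) cvg_id
    (1/2) uh).
move: nW; apply: (@filterS2 R) => y Wy yh.
by rewrite /preimage /= centered_pi.
Qed.

End Circle.

Section IntegerValued.
Variable R : realType.

Lemma int_valued_constant (f : R -> R) :
  continuous f -> (forall x, f x \is a Num.int) -> forall x y, f x = f y.
Proof.
move=> cf fZ.
suff H x y : x <= y -> f x = f y.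
  by move=> x y; have [/H//|/ltW/H] := leP x y.
move=> xy; have /intrP[m fx] := fZ x; have /intrP[n fy] := fZ y.
apply: contrapT => /eqP fxy.
have cW : {within `[x, y], continuous f} by apply: continuous_subspaceT.
pose v : R := (Num.min m n)%:~R + 1/2.
have mn : m != n by apply: contra fxy => /eqP mn; rewrite fx fy mn.
have [|c _ fc] := @IVT R f x y v xy cW.
  rewrite fx fy /v; case: (ltgtP m n) mn => // mn _.
    have mn1 : m%:~R + 1 <= n%:~R :> R.
      by rewrite -[1]/(1%:~R) -intrD ler_int lezD1.
    by rewrite min_l; [rewrite max_r|]; [apply/andP; split|..]; lra.
  have mn1 : n%:~R + 1 <= m%:~R :> R.
    by rewrite -[1]/(1%:~R) -intrD ler_int lezD1.
  by rewrite min_r; [rewrite max_l|]; [apply/andP; split|..]; lra.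
have := fZ c; rewrite fc /v rpredDl ?intr_int// => /intrP[k hk].
have k0 : 0%:~R < k%:~R :> R by rewrite -hk; lra.
have k1 : k%:~R < 1%:~R :> R by rewrite -hk; lra.
by move: k0 k1; rewrite !ltr_int; case: k {hk} => [[|[]]|].
Qed.

End IntegerValued.

Section HomotopyLifting.
Variables (R : realType) (Y : topologicalType) (p : R * Y -> circle R).
Hypothesis p_cont : continuous p.
Local Notation pi := (\pi_(circle R)).

Let fine_at (N : nat) (y : Y) := forall s s', 0 <= s <= 1 -> s <= s' ->
  s' <= s + N.+1%:R^-1 -> `|centered (p (s', y) - p (s, y))| < 1/2.

Let fine_near (x : Y) : exists N, \forall y \near x, fine_at N y.
Proof.
pose q (z : (R * R) * Y) := centered (p (z.1.1, z.2) - p (z.1.2, z.2)).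
have qc s : {for ((s, s), x), continuous q}.
  apply: (@continuous_comp _ (circle R) R
    (fun z : (R * R) * Y => p (z.1.1, z.2) - p (z.1.2, z.2)) (@centered R)).
    have c1 : continuous (fun z : (R * R) * Y => z.1.1).
      by move=> z; exact: (@continuous_comp _ _ _ fst fst z cvg_fst cvg_fst).
    have c2 : continuous (fun z : (R * R) * Y => z.1.2).
      by move=> z; exact: (@continuous_comp _ _ _ fst snd z cvg_fst cvg_snd).
    apply: continuous_circleB => z; apply: continuous_comp;
      try exact: p_cont; apply: continuous_pair; try exact: cvg_snd.
      exact: c1.
    exact: c2.
  apply: centered_continuous; rewrite /= subrr centered0 normr0; lra.
have /compact_near_coveringP cov := @segment_compact R 0 1.
have := cov (nat * Y)%type (filter_prod \oo (nbhs x))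
  (fun Ny s => forall s', s <= s' -> s' <= s + Ny.1.+1%:R^-1 ->
     `|centered (p (s', Ny.2) - p (s, Ny.2))| < 1/2) _.
case=> [s _|[M V] /= [[N _ MN] nV] MV].
  have q0 : `|q (s, s, x)| < 1/2.
    by rewrite /q /= subrr centered0 normr0; lra.
  have [[W V] /= [[[W1 W2] /= [nW1 nW2] WW] nV] WV] :=
    @cvgr_norm_lt R R^o _ _ _ q _ (qc s) _ q0.
  move/nbhs_ballP : nW1 => [e1 /= e10 eW1].
  move/nbhs_ballP : nW2 => [e2 /= e20 eW2].
  have e0 : 0 < Num.min (e1 / 2) (e2 / 2) by rewrite lt_min !divr_gt0.
  exists (ball s (Num.min (e1 / 2) (e2 / 2)),
    ([set N | N.+1%:R^-1 < Num.min (e1 / 2) (e2 / 2)] `*` V)) => /=.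
    split; first exact: nbhsx_ballx.
    exists ([set N | N.+1%:R^-1 < Num.min (e1 / 2) (e2 / 2)], V) => //=.
    split => //; exact: near_infty_natSinv_lt (PosNum e0).
  move=> [t [N y]] /= [st [Ne Vy]] t' tt' t't.
  move: Ne t't; set h := N.+1%:R^-1 => Ne t't.
  move: st Ne; rewrite /ball /= !lt_min => /andP[st1 st2] /andP[Ne1 Ne2].
  apply: (WV ((t', t), y)); split => //=; apply: (WW (t', t)); split => /=.
    apply: eW1; rewrite /ball /=; move: st1; rewrite !ltr_norml.
    by move=> /andP[? ?]; apply/andP; split; lra.
  by apply: eW2; rewrite /ball /=; lra.
exists N; apply: filterS nV => y Vy s s' s01 ss' s's.
by apply: (MV (N, y)) => //; split => //; exact: (MN N (leqnn N)).
Qed.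

(* The winding of the path s |-> p (s, y) on [0, z.1], accumulated over N + 1
   equal steps; it depends continuously on z as long as no step reaches the
   antipode, where centered jumps. *)
Let lift_at (N : nat) (z : R * Y) : R := \sum_(i < N.+1)
  centered (p (Num.min z.1 (i.+1%:R / N.+1%:R), z.2) -
            p (Num.min z.1 (i%:R / N.+1%:R), z.2)).

Let lift_atK N z :
  pi (lift_at N z) = p (Num.min z.1 1, z.2) - p (Num.min z.1 0, z.2).
Proof.
rewrite /lift_at circle_pi_sum; under eq_bigr do rewrite centeredK.
rewrite -(big_mkord xpredT (fun i =>
  p (Num.min z.1 (i.+1%:R / N.+1%:R), z.2) -
  p (Num.min z.1 (i%:R / N.+1%:R), z.2))).
rewrite (telescope_sumr (fun i => p (Num.min z.1 (i%:R / N.+1%:R), z.2)))//.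
by rewrite divff// mul0r.
Qed.

Let lift_at_continuous N x s :
  fine_at N x -> {for (s, x), continuous (lift_at N)}.
Proof.
move=> xN; rewrite /lift_at; apply: cvg_big => [|i _].
  exact: add_continuous.
have c (a : R) : continuous (fun z : R * Y => p (Num.min z.1 a, z.2)).
  move=> z; apply: continuous_comp; last exact: p_cont.
  apply: continuous_pair; last exact: cvg_snd.
  by apply: continuous_min; [exact: cvg_fst|exact: cvg_cst].
apply: (@continuous_comp _ (circle R) R (fun z : R * Y =>
  p (Num.min z.1 (i.+1%:R / N.+1%:R), z.2) -
  p (Num.min z.1 (i%:R / N.+1%:R), z.2)) (@centered R)).
  by apply: continuous_circleB; exact: c.
apply: centered_continuous => /=.
have ai : i.+1%:R / N.+1%:R = i%:R / N.+1%:R + N.+1%:R^-1 :> R.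
  by rewrite -addn1 natrD mulrDl mul1r.
have a1 : i.+1%:R / N.+1%:R <= 1 :> R by rewrite ler_pdivrMr ?mul1r ?ler_nat.
have a0 : 0 <= i%:R / N.+1%:R :> R by [].
have h0 : 0 <= N.+1%:R^-1 :> R by [].
move: ai a0 a1 h0 (xN); rewrite /fine_at.
set a := i%:R / _; set a' := i.+1%:R / _; set h := _^-1 => ai a0 a1 h0 {}xN.
have [sa|/ltW as_] := leP s a.
  have -> : Num.min s a' = s by rewrite min_l//; lra.
  by rewrite subrr centered0 normr0; lra.
apply: xN; first by apply/andP; split; lra.
  by rewrite le_min as_; lra.
by rewrite ge_min; apply/orP; right; lra.
Qed.

Lemma homotopy_lifting : exists g : Y -> R,
  continuous g /\ forall y, pi (g y) = p (1, y) - p (0, y).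
Proof.
have [N xN] := choice fine_near.
have fineN x : fine_at (N x) x by have := nbhs_singleton (xN x).
have lift_at_eq x m n : fine_at m x -> fine_at n x ->
    lift_at m (1, x) = lift_at n (1, x).
  move=> xm xn; apply/eqP; rewrite -subr_eq0; apply/eqP.
  pose D s := lift_at m (s, x) - lift_at n (s, x).
  have Dc : continuous D.
    move=> s.
    have c k : fine_at k x -> {for s, continuous (fun s => lift_at k (s, x))}.
      move=> xk; apply: (@continuous_comp _ _ _ (fun s => (s, x))).
        by apply: continuous_pair; [exact: cvg_id|exact: cvg_cst].
      exact: lift_at_continuous.
    exact: continuousB (c m xm) (c n xn).
  have DZ s : D s \is a Num.int.
    by apply/circle_piP; rewrite !lift_atK.
  rewrite -/(D 1) (int_valued_constant Dc DZ 1 0) /D /lift_at.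
  have min0 (k i : nat) : Num.min 0 (i%:R / k.+1%:R) = 0 :> R by rewrite min_l.
  by rewrite !big1 ?subrr// => i _; rewrite !min0 subrr centered0.
exists (fun x => lift_at (N x) (1, x)); split => [x|x]; last first.
  by rewrite lift_atK /= minxx min_r.
have c : {for x, continuous (fun y => lift_at (N x) (1, y))}.
  apply: (@continuous_comp Y (R * Y)%type R (fun y => (1, y)) (lift_at (N x))).
    by apply: continuous_pair; [exact: cvg_cst|exact: cvg_id].
  exact: lift_at_continuous.
move=> W /c; apply: filterS2 (xN x) => y yN /=.
by rewrite /preimage /= (lift_at_eq _ _ _ yN (fineN y)).
Qed.

End HomotopyLifting.

Section Rates.
Variable R : realType.
Local Notation pi := (\pi_(circle R)).

Definition eventually_bounded (u : R -> R) :=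
  exists M, \forall t \near +oo, `|u t| <= M.

Lemma eventually_bounded_rate (u : R -> R) :
  eventually_bounded u -> u t / t @[t --> +oo] --> 0.
Proof.
move=> [M uM]; apply/cvgrPdist_lt => e e0; near=> t.
have t0 : 0 < t by near: t; apply: nbhs_pinfty_gt; exact: num_real.
rewrite sub0r normrN normrM normfV (gtr0_norm t0) ltr_pdivrMr//.
apply: (@le_lt_trans _ _ M); first by near: t.
rewrite mulrC -ltr_pdivrMr//.
by near: t; apply: nbhs_pinfty_gt; exact: num_real.
Unshelve. all: by end_near. Qed.

Lemma rate_add_bounded (u v : R -> R) (a : R) : eventually_bounded v ->
  u t / t @[t --> +oo] --> a -> (u t + v t) / t @[t --> +oo] --> a.
Proof.
move=> /eventually_bounded_rate v0 ua; rewrite -[a]addr0.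
under eq_fun do rewrite mulrDl.
exact: cvgD ua v0.
Qed.

Lemma eventually_bounded_linear_rate (v : R -> R) (a : R) :
  eventually_bounded v -> (t * a + v t) / t @[t --> +oo] --> a.
Proof.
move=> vb; apply: rate_add_bounded => //.
apply: (@cvg_trans _ ((fun t : R => a) t @[t --> +oo])); last exact: cvg_cst.
apply: near_eq_cvg; near=> t.
have t0 : 0 < t by near: t; apply: nbhs_pinfty_gt; exact: num_real.
by rewrite mulrC mulKf ?gt_eqF.
Unshelve. all: by end_near. Qed.

Lemma eventually_bounded_cst (c : R) : eventually_bounded (fun=> c).
Proof. by exists `|c|; exact: nearW. Qed.

Lemma is_lift_rate_unique (f : R -> circle R) g h (a b : R) :
  is_lift f g -> is_lift f h ->
  g t / t @[t --> +oo] --> a -> h t / t @[t --> +oo] --> b -> a = b.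
Proof.
move=> [gc gf] [hc hf] ga hb.
have dc : continuous (fun t => g t - h t).
  by move=> t; exact: continuousB (gc t) (hc t).
have dZ t : g t - h t \is a Num.int by apply/circle_piP; rewrite gf hf.
pose c := g 0 - h 0.
have gh : (fun t => g t / t) = (fun t => (h t + c) / t).
  apply/funext => t; congr (_ / _).
  by rewrite /c -(int_valued_constant dc dZ t 0) addrC subrK.
move: ga; rewrite gh => ga.
exact: (cvg_unique _ ga (rate_add_bounded (eventually_bounded_cst c) hb)).
Qed.

End Rates.

Section Schwartzman.
Variables (R : realType) (X : ptopologicalType) (T : homeo X).
Local Notation S := (susp R T).
Local Notation pi := (\pi_(circle R)).

Lemma susp_orbit_continuous (x : S) : continuous (fun t => susp_flow t x).
Proof.
move=> t; apply: (@continuous_comp _ (X * R)%type S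
  (fun t => ((repr x).1, (repr x).2 + t)) \pi_S); last exact: pi_continuous.
apply: continuous_pair; first exact: cst_continuous.
by apply: cvgD; [exact: cvg_cst|exact: cvg_id].
Qed.

Lemma homotopic_lift (Y : topologicalType) (f g : Y -> circle R) :
  homotopic f g -> exists h : Y -> R,
    continuous h /\ forall y, pi (h y) = g y - f y.
Proof.
move=> [H [Hc H0 H1]].
pose clamp (s : R) := Num.max 0 (Num.min 1 s).
have clampc : continuous clamp.
  move=> s; apply: continuous_max; first exact: cst_continuous.
  by apply: continuous_min; [exact: cst_continuous|exact: cvg_id].
pose p (z : R * Y) := H (z.2, clamp z.1).
have pc : continuous p.
  move=> z; move/subspace_continuousP : Hc => /(_ (z.2, clamp z.1)) Hc.
  have Az s : `[0, 1]%classic (clamp s).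
    by rewrite /= in_itv /= /clamp le_max lexx ge_max ler01 ge_min lexx.
  have cc : {for z, continuous (fun z : R * Y => (z.2, clamp z.1))}.
    apply: continuous_pair; first exact: cvg_snd.
    apply: (@continuous_comp _ R R fst clamp); first exact: cvg_fst.
    exact: clampc.
  move=> W /Hc - /(_ (conj I (Az _))) /cc.
  by apply: (@filterS (R * Y)) => y Wy; apply: Wy; split => //=; exact: Az.
have [h [hc hp]] := homotopy_lifting pc; exists h; split => // y.
rewrite hp /p /= /clamp minxx max_r ?ler01// min_r ?ler01// maxxx.
by rewrite H0 H1.
Qed.

Lemma homotopic_refl (Y : topologicalType) (f : Y -> circle R) :
  continuous f -> homotopic f f.
Proof.
move=> fc; exists (fun z => f z.1); split => //.
apply: continuous_subspaceT => z.
apply: (@continuous_comp _ Y (circle R) fst f); first exact: cvg_fst.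
exact: fc.
Qed.

Lemma schwartzman_everywhere_rate (mu : probability (borel X) R)
    (phi : S -> circle R) (a : R) :
  (forall g : S -> R, continuous g ->
    forall x, eventually_bounded (fun t => g (susp_flow t x))) ->
  continuous phi ->
  (forall x, exists2 g : R -> R, is_lift (fun t => phi (susp_flow t x)) g &
     g t / t @[t --> +oo] --> a) ->
  schwartzman mu (homotopy_class phi) = a.
Proof.
move=> bounded phic phia; apply: xget_unique => [psi [psic hpsi]|b].
  apply: aeW => x.
  have [h [hc hE]] := homotopic_lift hpsi.
  have [g [gc gE] ga] := phia x.
  exists (fun t => g t + h (susp_flow t x)); last first.
    by apply: rate_add_bounded ga; exact: bounded.
  split => [t|t]; last by rewrite circle_piD gE hE addrC subrK.
  have c2 : {for t, continuous (fun t => h (susp_flow t x))}.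
    apply: (@continuous_comp _ S R (fun t => susp_flow t x) h).
      exact: susp_orbit_continuous.
    exact: hc.
  exact: continuousD (gc t) c2.
move=> /(_ phi (conj phic (homotopic_refl phic))) phib.
have mu1 : (0%R < susp_measure T mu setT)%E by rewrite probability_setT lte01.
have /filter_ex := phib.
case=> [|x [h hl hb]].
  exact: ae_properfilter_algebraOfSetsType.
have [g gl ga] := phia x.
by rewrite (is_lift_rate_unique gl hl ga hb).
Qed.

End Schwartzman.

Section NormedSpace.
Variables (R : realType) (V : normedModType R).

Lemma scale_line_continuous (v : V) : continuous (fun s : R => s *: v).
Proof. by move=> s; apply: cvgZ; [exact: cvg_id|exact: cvg_cst]. Qed.

Lemma int_valued_constant_normed (f : V -> R) :
  continuous f -> (forall v, f v \is a Num.int) -> forall v, f v = f 0.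
Proof.
move=> fc fZ v.
have c : continuous (fun s : R => f (s *: v)).
  move=> s; apply: (@continuous_comp _ V R (fun s : R => s *: v) f).
    exact: scale_line_continuous.
  exact: fc.
by have := int_valued_constant c (fun s => fZ _) 1 0; rewrite scale1r scale0r.
Qed.

Lemma circle_lift_normed (F : V -> circle R) : continuous F ->
  exists g : V -> R, continuous g /\ forall v, \pi_(circle R) (g v) = F v.
Proof.
move=> Fc; pose p (z : R * V) := F (z.1 *: z.2).
have pc : continuous p.
  move=> z; apply: (@continuous_comp _ V (circle R)
    (fun z : R * V => z.1 *: z.2) F).
    by apply: cvgZ; [exact: cvg_fst|exact: cvg_snd].
  exact: Fc.
have [g [gc gE]] := homotopy_lifting pc.
exists (fun v => g v + repr (F 0)); split => v.
  have c2 : {for v, continuous (fun=> repr (F 0) : R)} by exact: cst_continuous.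
  exact: continuousD (gc v) c2.
by rewrite circle_piD gE reprK /p /= scale1r scale0r subrK.
Qed.

End NormedSpace.

Section IntegerVectors.
Variables (R : realType) (d : nat).
Implicit Types (k m : 'cV[int]_d) (x : 'cV[R]_d).

Definition intv m : 'cV[R]_d := map_mx intr m.

Definition dot k x : R := \sum_i (k i 0)%:~R * x i 0.

Lemma torus_piP x y :
  \pi_(torus R d) x = \pi_(torus R d) y <-> exists m, x = y + intv m.
Proof.
split => [/zquotP/forallP xy|[m ->]].
  exists (\col_i Num.floor ((x - y) i 0)); apply/matrixP => i j.
  have := xy i; rewrite intrEfloor => /eqP xyi.
  rewrite (ord1 j) [RHS]mxE [intv _ _ _]mxE [X in X%:~R]mxE xyi.
  by rewrite !mxE addrC subrK.
apply/(zquotP (Zdpts (R := R) (d := d))); rewrite addrAC subrr add0r.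
by apply/forallP => i; rewrite mxE intr_int.
Qed.

Lemma nbhs_torus_pi x (W : set (torus R d)) :
  nbhs (\pi_(torus R d) x) W <-> nbhs x (\pi_(torus R d) @^-1` W).
Proof. exact: (@nbhs_zquot_pi 'cV[R]_d (Zdpts (R := R) (d := d))). Qed.

Lemma dotE k x : dot k x = ((map_mx intr k)^T *m x) 0 0.
Proof. by rewrite mxE; apply: eq_bigr => i _; rewrite !mxE. Qed.

Lemma dotD k x y : dot k (x + y) = dot k x + dot k y.
Proof. by rewrite !dotE mulmxDr mxE. Qed.

Lemma dot_delta k i : dot k (intv (delta_mx i 0)) = (k i 0)%:~R.
Proof.
rewrite /dot (bigD1 i)//= big1 => [|j ji]; rewrite !mxE ?eqxx ?mulr1 ?addr0//.
by rewrite (negbTE ji) mulr0.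
Qed.

Lemma mulmx_continuous (M : 'M[R]_d) :
  continuous (mulmx M : 'cV[R]_d -> 'cV[R]_d).
Proof.
have -> : mulmx M = (fun x : 'cV[R]_d => \sum_j x j 0 *: col j M).
  apply/funext => x; apply/matrixP => i j; rewrite mxE summxE.
  by apply: eq_bigr => l _; rewrite !mxE (ord1 j) mulrC.
apply: continuous_big => [|j _ x]; first exact: add_continuous.
have c1 : {for x, continuous (fun x : 'cV[R]_d => x j 0)}.
  exact: coord_continuous.
have c2 : {for x, continuous (fun=> col j M)} by exact: cst_continuous.
exact: continuousZ c1 c2.
Qed.

Lemma dot_mul (A : 'M[int]_d) k x :
  dot k (map_mx intr A *m x) = dot (A^T *m k) x.
Proof. by rewrite !dotE map_mxM -map_trmx trmx_mul trmxK mulmxA. Qed.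

Lemma dot_intv_int k m : dot k (intv m) \is a Num.int.
Proof. by apply: rpred_sum => i _; rewrite mxE rpredM ?intr_int. Qed.

Lemma dot_continuous k : continuous (dot k).
Proof.
rewrite /dot; apply: continuous_big => [|i _ x]; first exact: add_continuous.
have c1 : {for x, continuous (fun=> (k i 0)%:~R : R)} by exact: cst_continuous.
have c2 : {for x, continuous (fun x : 'cV[R]_d => x i 0)}.
  exact: coord_continuous.
exact: continuousM c1 c2.
Qed.

Lemma additive_intv_dot (c : 'cV[int]_d -> R) (k : 'cV[int]_d) :
  (forall m m', c (m - m') = c m - c m') ->
  (forall i, c (delta_mx i 0) = (k i 0)%:~R) ->
  forall m, c m = dot k (intv m).
Proof.
move=> cB ck m.
pose cZ := GRing.isZmodMorphism.Build _ _ c cB.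
pose ca : {additive 'cV[int]_d -> R} := HB.pack c cZ.
rewrite -[c]/(ca : _ -> _) [in LHS](matrix_sum_delta m) raddf_sum.
apply: eq_bigr => i _; rewrite big_ord1 mxE mulrC.
by rewrite -[m i 0 in LHS]intz scaler_int raddfMz /= ck -mulrzl.
Qed.

Lemma continuous_box_bounded (G : 'cV[R]_d * R -> R) : continuous G ->
  exists M, forall x t, (forall i, 0 <= x i 0 <= 1) -> 0 <= t <= 1 ->
    `|G (x, t)| <= M.
Proof.
move=> Gc; pose G' (z : 'rV[R]_d * R) := G (z.1^T, z.2).
have trc : continuous (fun v : 'rV[R]_d => v^T).
  move=> v W [P nP PW]; exists (fun i j => P j i) => [i j|w Pw].
    by have := nP j i; rewrite mxE.
  by apply: PW => i j; rewrite mxE; exact: Pw.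
have G'c : continuous G'.
  move=> z; apply: (@continuous_comp _ ('cV[R]_d * R)%type R
    (fun z : 'rV[R]_d * R => (z.1^T, z.2)) G); last exact: Gc.
  apply: continuous_pair; last exact: cvg_snd.
  by apply: (@continuous_comp _ _ _ fst (fun v : 'rV[R]_d => v^T));
    [exact: cvg_fst|exact: trc].
have cK := compact_setX (@rV_compact R d (fun=> `[0, 1]%classic)
  (fun=> @segment_compact R 0 1)) (@segment_compact R 0 1).
have /compact_bounded := continuous_compact (continuous_subspaceT G'c) cK.
move=> /pinfty_ex_gt0[M M0 bM]; exists M => x t x01 t01.
apply: (bM (G (x, t))); exists (x^T, t); last by rewrite /G' /= trmxK.
by split => [i|] /=; rewrite in_itv//= mxE.
Qed.

End IntegerVectors.

Section TorusSuspension.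
Variables (R : realType) (d : nat) (A : 'M[int]_d) (detA : \det A = 1).
Variables (b : torus R d) (b0 : 'cV[R]_d) (b0b : \pi_(torus R d) b0 = b).
Local Notation T := (torus_homeo detA b).
Local Notation S := (susp R T).
Local Notation V := 'cV[R]_d.
Local Notation pi := (\pi_(circle R)).

Definition affine_lift (x : V) : V := map_mx intr A *m x + b0.

Definition cover (z : V * R) : S := \pi_S (\pi_(torus R d) z.1, z.2).

Let affine_lift_pi x :
  T (\pi_(torus R d) x) = \pi_(torus R d) (affine_lift x).
Proof.
rewrite /= /torus_affine torus_mul_pi -b0b.
exact: (@torusD_pi R d).
Qed.

Lemma cover_continuous : continuous cover.
Proof.
move=> z; apply: (@continuous_comp _ (torus R d * R)%type S
  (fun z : V * R => (\pi_(torus R d) z.1, z.2)) \pi_S); last first.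
  exact: pi_continuous.
apply: continuous_pair; last exact: cvg_snd.
apply: (@continuous_comp _ V (torus R d) fst \pi_(torus R d)).
  exact: cvg_fst.
exact: pi_continuous.
Qed.

Lemma cover_surj y : exists z, y = cover z.
Proof.
exists (repr (repr y).1, (repr y).2); rewrite /cover /= reprK.
by rewrite -surjective_pairing reprK.
Qed.

Lemma cover_intv x m t : cover (x + intv R m, t) = cover (x, t).
Proof.
by rewrite /cover /= (_ : \pi_(torus R d) _ = \pi_(torus R d) x)//;
  apply/torus_piP; exists m.
Qed.

Lemma cover_affine x t : cover (affine_lift x, t) = cover (x, t + 1).
Proof.
apply/esym/suspP; exists 1.
congr (_, _); first exact/esym/affine_lift_pi.
by rewrite /= addrK.
Qed.

Lemma susp_flow_cover t x s : susp_flow t (cover (x, s)) = cover (x, s + t).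
Proof. exact: susp_flow_pi. Qed.

Section Invariant.
Variables (Z : Type) (F : V * R -> Z).
Hypothesis F_intv : forall x m t, F (x + intv R m, t) = F (x, t).
Hypothesis F_affine : forall x t, F (affine_lift x, t) = F (x, t + 1).

Lemma cover_invariant z z' : cover z = cover z' -> F z = F z'.
Proof.
have H (n : nat) x x' t : \pi_(torus R d) x' = iter n T (\pi_(torus R d) x) ->
    F (x', t) = F (x, t + n%:R).
  elim: n x => [|n IHn] x; last first.
    rewrite iterSr affine_lift_pi => /IHn ->.
    by rewrite F_affine -addrA -natr1.
  by move=> /torus_piP[m ->]; rewrite F_intv addr0.
case: z => x t; case: z' => x' t' /suspP[n /= [xx' ->]].
case: n xx' => n xx'; first by rewrite (H n x x')// subrK.
rewrite NegzE rmorphN /= opprK; apply: H.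
by rewrite -[iter _ _ _]/(hiter T (- Negz n) _) xx' -hiterD addNr.
Qed.

End Invariant.

Lemma cover_descent (Z : topologicalType) (F : V * R -> Z) :
  continuous F ->
  (forall x m t, F (x + intv R m, t) = F (x, t)) ->
  (forall x t, F (affine_lift x, t) = F (x, t + 1)) ->
  exists phi : S -> Z, continuous phi /\ forall z, phi (cover z) = F z.
Proof.
move=> Fc F_intv F_affine.
pose phi (y : S) := F (repr (repr y).1, (repr y).2).
have phiE z : phi (cover z) = F z.
  apply: cover_invariant => //.
  by rewrite /cover /= reprK -surjective_pairing reprK.
exists phi; split => //; apply/quotient_continuous => -[w t] W.
rewrite -(reprK w) => /= nW.
have : nbhs (repr w, t) (F @^-1` W).
  by apply: Fc; rewrite -phiE /cover /= reprK; move: nW; rewrite reprK.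
move=> [[P Q] /= [nP nQ] PQ]; exists (\pi_(torus R d) @` P, Q).
  split => //=; apply/nbhs_torus_pi; move: nP; apply: (@filterS V).
  by move=> x Px; exists x.
move=> [_ t'] /= [[x Px <-] Qt'].
by rewrite /preimage /= -[\pi_S _]/(cover (x, t')) phiE; exact: (PQ (x, t')).
Qed.

Lemma invariant_eventually_bounded (G : V * R -> R) :
  continuous G ->
  (forall x m t, G (x + intv R m, t) = G (x, t)) ->
  (forall x t, G (affine_lift x, t) = G (x, t + 1)) ->
  forall x s, eventually_bounded (fun t => G (x, s + t)).
Proof.
move=> Gc G_intv G_affine x s; have [M bM] := continuous_box_bounded Gc.
have bN (n : nat) y t : 0 <= t <= 1 -> `|G (y, t + n%:R)| <= M.
  elim: n y => [|n IHn] y t01; last first.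
    by rewrite -natr1 addrA -G_affine IHn.
  pose m : 'cV[int]_d := \col_i Num.floor (y i 0).
  rewrite addr0 -(subrK (intv R m) y) G_intv; apply: bM => // i.
  rewrite !mxE; have /andP[y1 y2] := floor_itv (y i 0).
  by move: y2; rewrite intrD => y2; apply/andP; split; lra.
exists M; near=> t.
have st0 : 0 <= s + t.
  rewrite -lerBlDl sub0r; near: t; apply: nbhs_pinfty_ge; exact: num_real.
have /andP[t1 t2] := truncn_itv st0.
rewrite -(subrK (Num.trunc (s + t))%:R (s + t)); apply: bN.
by move: t2; rewrite -natr1 => t2; apply/andP; split; lra.
Unshelve. all: by end_near. Qed.

Lemma susp_eventually_bounded (g : S -> R) : continuous g ->
  forall x, eventually_bounded (fun t => g (susp_flow t x)).
Proof.
move=> gc y; have [[x s] ->] := cover_surj y.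
under [fun t => _]eq_fun do rewrite susp_flow_cover.
apply: (@invariant_eventually_bounded (g \o cover)) => [z|x' m t|x' t] /=.
- apply: (@continuous_comp _ S R cover g); first exact: cover_continuous.
  exact: gc.
- by rewrite cover_intv.
- by rewrite cover_affine.
Qed.

Lemma schwartzman_lift (mu : probability (borel (torus R d)) R)
    (phi : S -> circle R) (g : V * R -> R) (a : R) :
  continuous phi -> continuous g -> (forall z, pi (g z) = phi (cover z)) ->
  (forall x s, g (x, s + t) / t @[t --> +oo] --> a) ->
  schwartzman mu (homotopy_class phi) = a.
Proof.
move=> phic gc gE ga; apply: schwartzman_everywhere_rate => //.
  exact: susp_eventually_bounded.
move=> y; have [[x s] ->] := cover_surj y.
exists (fun t => g (x, s + t)) => //; split => [t|t]; last first.
  by rewrite gE susp_flow_cover.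
apply: (@continuous_comp _ (V * R)%type R (fun t => (x, s + t)) g); last first.
  exact: gc.
apply: continuous_pair; first exact: cst_continuous.
by apply: cvgD; [exact: cvg_cst|exact: cvg_id].
Qed.

Lemma dot_affine_lift k x : (1%:M - A^T) *m k = 0 ->
  dot k (affine_lift x) = dot k x + dot k b0.
Proof.
move=> /eqP; rewrite mulmxBl mul1mx subr_eq0 => /eqP kA.
by rewrite dotD dot_mul -kA.
Qed.

Lemma linear_continuous_cover k (a : R) :
  continuous (fun z : V * R => dot k z.1 + z.2 * a).
Proof.
move=> z; have c1 : {for z, continuous (fun z : V * R => dot k z.1)}.
  apply: (@continuous_comp _ V R fst (dot k)); first exact: cvg_fst.
  exact: dot_continuous.
have c2 : {for z, continuous (fun z : V * R => z.2)} by exact: cvg_snd.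
have c3 : {for z, continuous (fun=> a)} by exact: cst_continuous.
exact: continuousD c1 (continuousM c2 c3).
Qed.

Lemma schwartzman_range_mem (mu : probability (borel (torus R d)) R) k n :
  (1%:M - A^T) *m k = 0 -> schwartzman_range T mu (dot k b0 + n%:~R).
Proof.
move=> kA; set a := _ + _.
pose g (z : V * R) := dot k z.1 + z.2 * a.
have gc : continuous g by exact: linear_continuous_cover.
have [|x m t|x t|phi [phic phiE]] := @cover_descent (circle R) (pi \o g).
- move=> z; apply: (@continuous_comp _ R (circle R) g pi); first exact: gc.
  exact: pi_continuous.
- rewrite /g /= dotD addrAC circle_piD.
  by rewrite (circle_pi_int (dot_intv_int _ _ _)) addr0.
- rewrite /g /= dot_affine_lift//; apply/circle_piP.
  rewrite (_ : _ - _ = - n%:~R) ?rpredN ?intr_int// /a; ring.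
exists (homotopy_class phi); first by exists phi.
apply: (@schwartzman_lift _ _ g) => // [z|x s]; first by rewrite phiE.
rewrite (_ : (fun t => _) = (fun t => (t * a + (dot k x + s * a)) / t)).
  exact/eventually_bounded_linear_rate/eventually_bounded_cst.
by apply/funext => t; rewrite /g /=; congr (_ / _); ring.
Qed.

Lemma schwartzman_homotopy_class (mu : probability (borel (torus R d)) R)
    (phi : S -> circle R) : continuous phi ->
  exists k n, (1%:M - A^T) *m k = 0 /\
    schwartzman mu (homotopy_class phi) = dot k b0 + n%:~R.
Proof.
move=> phic.
have [|g [gc gE]] := @circle_lift_normed R (V * R)%type (phi \o cover).
  move=> z; apply: (@continuous_comp _ S (circle R) cover phi).
    exact: cover_continuous.
  exact: phic.
(* g changes by a constant integer under every deck transformation h. *)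
have shift (h : V * R -> V * R) : continuous h ->
    (forall z, cover (h z) = cover z) ->
    (forall z, g (h z) - g z = g (h 0) - g 0) /\ g (h 0) - g 0 \is a Num.int.
  move=> hc hE.
  have ghZ z : g (h z) - g z \is a Num.int.
    by apply/circle_piP; rewrite !gE /= hE.
  split => // z; apply: (int_valued_constant_normed _ ghZ) => {}z.
  have c1 : {for z, continuous (fun z => g (h z))}.
    by apply: (@continuous_comp _ (V * R)%type R h g); [exact: hc|exact: gc].
  exact: continuousB c1 (gc z).
pose c (m : 'cV[int]_d) := g (intv R m, 0) - g 0.
have hm m : continuous (fun z : V * R => (z.1 + intv R m, z.2)).
  move=> z; apply: (@continuous_pair (V * R)%type V R); last exact: cvg_snd.
  have c1 : {for z, continuous (fun z : V * R => z.1)} by exact: cvg_fst.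
  have c2 : {for z, continuous (fun=> intv R m)} by exact: cst_continuous.
  exact: continuousD c1 c2.
have shift_intv x m t : g (x + intv R m, t) = g (x, t) + c m.
  have [|+ _] := shift _ (hm m); first by move=> [y s]; exact: cover_intv.
  by move=> /(_ (x, t)) /=; rewrite add0r /c => <-; rewrite [RHS]addrC subrK.
have cZ m : c m \is a Num.int.
  have [|_] := shift _ (hm m); first by move=> [y s]; exact: cover_intv.
  by rewrite /= add0r.
have cB m m' : c (m - m') = c m - c m'.
  have := shift_intv (intv R (m - m')) m' 0.
  rewrite {1}/intv -map_mxD subrK /c -/(intv R m).
  by move=> ->; ring.
pose k : 'cV[int]_d := \col_i Num.floor (c (delta_mx i 0)).
have ck m : c m = dot k (intv R m).
  apply: additive_intv_dot => // i; rewrite mxE.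
  by have := cZ (delta_mx i 0); rewrite intrEfloor => /eqP.
have aff_cont : continuous (fun z : V * R => (affine_lift z.1, z.2 - 1)).
  move=> z; apply: (@continuous_pair (V * R)%type V R).
    have c1 : {for z, continuous (fun z : V * R => map_mx intr A *m z.1)}.
      apply: (@continuous_comp _ V V fst (mulmx (map_mx intr A))).
        exact: cvg_fst.
      exact: mulmx_continuous.
    have c2 : {for z, continuous (fun=> b0 : V)} by exact: cst_continuous.
    exact: continuousD c1 c2.
  have c1 : {for z, continuous (fun z : V * R => z.2)} by exact: cvg_snd.
  have c2 : {for z, continuous (fun=> 1 : R)} by exact: cst_continuous.
  exact: continuousB c1 c2.
have [|shift_aff] := shift _ aff_cont.
  by move=> [x t]; rewrite cover_affine subrK.
set r := _ - _ in shift_aff * => /intrP[n rn].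
have {shift_aff} g_affine x t : g (affine_lift x, t) = g (x, t + 1) + n%:~R.
  have := shift_aff (x, t + 1); rewrite /= addrK rn => <-.
  by rewrite [RHS]addrC subrK.
have cA m : c (A *m m) = c m.
  have := g_affine (0 + intv R m) 0.
  have -> : affine_lift (0 + intv R m) = affine_lift 0 + intv R (A *m m).
    by rewrite /affine_lift mulmxDr addrAC /intv map_mxM.
  by rewrite !shift_intv g_affine; lra.
have kA : (1%:M - A^T) *m k = 0.
  rewrite mulmxBl mul1mx; apply/eqP; rewrite subr_eq0; apply/eqP.
  apply/matrixP => i j; rewrite (ord1 j).
  apply: (@intr_inj R); rewrite -!dot_delta -dot_mul.
  have -> : map_mx intr A *m intv R (delta_mx i 0) = intv R (A *m delta_mx i 0).
    by rewrite /intv map_mxM.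
  by rewrite -!ck cA.
exists k, (- n); split => //.
set a := _ + _.
pose lin (z : V * R) := dot k z.1 + z.2 * a.
pose G z := g z - lin z.
apply: (@schwartzman_lift _ _ g) => // x s.
rewrite (_ : (fun t => _) =
    (fun t => ((t * a + (dot k x + s * a)) + G (x, s + t)) / t)); last first.
  by apply/funext => t; rewrite /G /lin /=; congr (_ / _); ring.
apply: rate_add_bounded; last first.
  exact/eventually_bounded_linear_rate/eventually_bounded_cst.
apply: invariant_eventually_bounded => [z|y m t|y t].
- exact: continuousB (gc z) (@linear_continuous_cover k a z).
- by rewrite /G /lin /= shift_intv ck dotD; ring.
- by rewrite /G /lin /= g_affine dot_affine_lift// /a rmorphN/=; ring.
Qed.

End TorusSuspension.

Theorem theorem8p1 (R : realType) (d : nat) (A : 'M[int]_d)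
    (detA : \det A = 1) (b : torus R d) (b0 : 'cV[R]_d)
    (b0b : \pi_(torus R d) b0 = b)
    (mu : probability (borel (torus R d)) R) :
  ergodic (torus_homeo detA b) mu ->
  schwartzman_range (torus_homeo detA b) mu =
  [set r | exists (k : 'cV[int]_d) (n : int),
     (1%:M - A^T) *m k = 0 /\ r = \sum_i (k i 0)%:~R * b0 i 0 + n%:~R].
Proof.
move=> _; apply/seteqP; split => [r [_ [phi phic <-] <-]|r [k [n [kA ->]]]].
  exact: (schwartzman_homotopy_class b0b mu phic).
exact: (schwartzman_range_mem detA b0b mu n kA).
Qed.
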